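(* Let $\mathcal{A}$ and $\mathcal{B}$ be abelian categories and let $(F,G):\mathcal{A}\to\mathcal{B}$ be an adjoint pair (with $F:\mathcal{A}\to\mathcal{B}$ left adjoint to $G:\mathcal{B}\to\mathcal{A}$). Let $\mathcal{Y}\subseteq\mathcal{A}$ be a preenveloping subcategory and $\mathcal{X}\subseteq\mathcal{B}$ a precovering subcategory, both self-orthogonal and closed under extensions and direct summands. 1. If $FG(X)\cong X$ for any $X\in\mathcal{X}$, then $\mathrm{Ext}_{\mathcal{X}}^{i}(M,N)\cong\mathrm{Ext}_{G(\mathcal{X})}^{i}(G(M),G(N))$ for any $M,N\in\mathcal{B}$ (and all $i\geq 0$). 2. If $GF(Y)\cong Y$ for any $Y\in\mathcal{Y}$, then $\mathrm{Ext}_{\mathcal{Y}}^{i}(M,N)\cong\mathrm{Ext}_{F(\mathcal{Y})}^{i}(F(M),F(N))$ for any $M,N\in\mathcal{A}$ (and all $i\geq 0$).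
   Context: ''Subcategory'' means full subcategory closed under isomorphisms and containing the zero object. For a subcategory $\mathcal{X}$, $G(\mathcal{X})$ denotes the subcategory of objects isomorphic to $G(X)$ with $X\in\mathcal{X}$, and similarly for $F(\mathcal{Y})$. A subcategory $\mathcal{F}$ is self-orthogonal if $\mathrm{Ext}^i(F_1,F_2)=0$ for all $i\geq 1$ and all $F_1,F_2\in\mathcal{F}$. An $\mathcal{F}$-precover of $M$ is a morphism $\varphi:F\to M$ with $F\in\mathcal{F}$ such that $\mathrm{Hom}(F',\varphi)$ is surjective for all $F'\in\mathcal{F}$; an $\mathcal{F}$-preenvelope of $M$ is a morphism $\varphi:M\to F$ with $F\in\mathcal{F}$ such that $\mathrm{Hom}(\varphi,F')$ is surjective for all $F'\in\mathcal{F}$. $\mathcal{F}$ is precovering (preenveloping) if every object has an $\mathcal{F}$-precover ($\mathcal{F}$-preenvelope). A proper left $\mathcal{F}$-resolution of $M$ is a complex (not necessarily exact) $\cdots\to X_1\to X_0\to M\to 0$ with all $X_i\in\mathcal{F}$ which becomes exact after applying $\mathrm{Hom}(F,-)$ for every $F\in\mathcal{F}$. A coproper right $\mathcal{F}$-resolution of $N$ is a complex $0\to N\to Y^0\to Y^1\to\cdots$ with all $Y^i\in\mathcal{F}$ which becomes exact after applying $\mathrm{Hom}(-,F)$ for every $F\in\mathcal{F}$. Relative Ext groups (for $i\geq 0$): in part 1, for the classes $\mathcal{X}$ and $G(\mathcal{X})$, $\mathrm{Ext}^i_{\mathcal{F}}(M,N)=H^i(\mathrm{Hom}(X_\bullet,N))$,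 where $X_\bullet$ is the deleted complex (remove $M$) of a proper left $\mathcal{F}$-resolution of $M$; in part 2, for the classes $\mathcal{Y}$ and $F(\mathcal{Y})$, $\mathrm{Ext}^i_{\mathcal{F}}(M,N)=H^i(\mathrm{Hom}(M,Y^\bullet))$, where $Y^\bullet$ is the deleted complex (remove $N$) of a coproper right $\mathcal{F}$-resolution of $N$.
   Formalization: The isomorphisms FG(X) ≅ X for X in 𝒳 and GF(Y) ≅ Y for Y in 𝒴 are required to be natural in X and Y; with merely objectwise isomorphisms the claim fails (e.g. F = G = (−)² on finitely presented modules over the Leavitt algebra L(1,2)). *)

(* Defs.v *)
From HB Require Import structures.
From mathcomp Require Import all_boot all_algebra.
From mathcomp Require Import boolp.
From Stdlib Require Import Relations.

Set Implicit Arguments.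
Unset Strict Implicit.
Unset Printing Implicit Defensive.

Import GRing.Theory.
Local Open Scope ring_scope.

Reserved Notation "g \oc f" (at level 40, left associativity).

(* The decidable equality and choice operator carried by a zmodType are
   available on every abelian group in the presence of the classical axioms of
   boolp, so hom-groups in zmodType are no restriction. *)
Record preadditiveCat := PreadditiveCat {
  obj :> Type;
  hom : obj -> obj -> zmodType;
  idm : forall a, hom a a;
  comp : forall a b c, hom b c -> hom a b -> hom a c;
  compA : forall a b c d (h : hom c d) (g : hom b c) (f : hom a b),
    comp h (comp g f) = comp (comp h g) f;
  comp1m : forall a b (f : hom a b), comp (idm b) f = f;
  compm1 : forall a b (f : hom a b), comp f (idm a) = f;
  compDl : forall a b c (g g' : hom b c) (f : hom a b),
    comp (g + g') f = comp g f + comp g' f;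
  compDr : forall a b c (g : hom b c) (f f' : hom a b),
    comp g (f + f') = comp g f + comp g f'
}.

Arguments hom {p} a b.
Arguments idm {p} a.
Arguments comp {p a b c} g f.
Notation "g \oc f" := (comp g f).

Section Morphisms.
Variable C : preadditiveCat.
Implicit Types a b c : C.

Definition is_iso a b (f : hom a b) : Prop :=
  exists g : hom b a, g \oc f = idm a /\ f \oc g = idm b.

Definition isomorphic a b : Prop := exists f : hom a b, is_iso f.

Definition mono a b (f : hom a b) : Prop :=
  forall c (g h : hom c a), f \oc g = f \oc h -> g = h.

Definition epi a b (f : hom a b) : Prop :=
  forall c (g h : hom b c), g \oc f = h \oc f -> g = h.

(* A hom-group always contains 0, so uniqueness of the arrows from and to z
   says that they are all 0. *)
Definition zero_object (z : C) : Prop :=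
  forall a, (forall f : hom a z, f = 0) /\ (forall f : hom z a, f = 0).

Definition biproduct a b (s : C) (ia : hom a s) (ib : hom b s)
    (pa : hom s a) (pb : hom s b) : Prop :=
  [/\ pa \oc ia = idm a, pb \oc ib = idm b, pa \oc ib = 0, pb \oc ia = 0
    & ia \oc pa + ib \oc pb = idm s].

Definition is_kernel a b (f : hom a b) k (m : hom k a) : Prop :=
  f \oc m = 0 /\
  forall c (g : hom c a), f \oc g = 0 -> exists! h : hom c k, m \oc h = g.

Definition is_cokernel a b (f : hom a b) k (q : hom b k) : Prop :=
  q \oc f = 0 /\
  forall c (g : hom b c), g \oc f = 0 -> exists! h : hom k c, h \oc q = g.

Definition is_image a b (f : hom a b) i (m : hom i b) : Prop :=
  exists k (q : hom b k), is_cokernel f q /\ is_kernel q m.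

Definition exact a b c (f : hom a b) (g : hom b c) : Prop :=
  exists i (m : hom i b), is_image f m /\ is_kernel g m.

End Morphisms.

Record is_abelian (C : preadditiveCat) : Prop := IsAbelian {
  abelian_zero : exists z : C, zero_object z;
  abelian_biproduct : forall a b : C, exists (s : C)
    (ia : hom a s) (ib : hom b s) (pa : hom s a) (pb : hom s b),
    biproduct ia ib pa pb;
  abelian_kernel : forall (a b : C) (f : hom a b),
    exists (k : C) (m : hom k a), is_kernel f m;
  abelian_cokernel : forall (a b : C) (f : hom a b),
    exists (k : C) (q : hom b k), is_cokernel f q;
  abelian_mono_normal : forall (a b : C) (m : hom a b), mono m ->
    exists (c : C) (f : hom b c), is_kernel f m;
  abelian_epi_normal : forall (a b : C) (q : hom a b), epi q ->
    exists (c : C) (f : hom c a), is_cokernel f q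
}.

Record abelianCat := AbelianCat {
  abelian_preadditive :> preadditiveCat;
  abelianP : is_abelian abelian_preadditive
}.

Record functor (C D : preadditiveCat) := Functor {
  fobj :> C -> D;
  fmap : forall a b : C, hom a b -> hom (fobj a) (fobj b);
  fmap_id : forall a : C, fmap (idm a) = idm (fobj a);
  fmap_comp : forall (a b c : C) (g : hom b c) (f : hom a b),
    fmap (g \oc f) = fmap g \oc fmap f
}.

Arguments fmap {C D} _ {a b} _.

Section FunctorComp.
Variables (C D E : preadditiveCat) (T : functor D E) (S : functor C D).

Fact fcomp_id (a : C) : fmap T (fmap S (idm a)) = idm (T (S a)).
Proof. by rewrite !fmap_id. Qed.

Fact fcomp_comp (a b c : C) (g : hom b c) (f : hom a b) :
  fmap T (fmap S (g \oc f)) = fmap T (fmap S g) \oc fmap T (fmap S f).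
Proof. by rewrite !fmap_comp. Qed.

Definition fcomp : functor C E :=
  @Functor C E (fun a => T (S a)) (fun a b f => fmap T (fmap S f))
    fcomp_id fcomp_comp.

End FunctorComp.

Record adjunction (C D : preadditiveCat) (F : functor C D) (G : functor D C) :=
  Adjunction {
  adj : forall (a : C) (b : D), hom (F a) b -> hom a (G b);
  adj_bij : forall (a : C) (b : D), bijective (@adj a b);
  adj_natl : forall (a a' : C) (b : D) (g : hom (F a) b) (f : hom a' a),
    adj (g \oc fmap F f) = adj g \oc f;
  adj_natr : forall (a : C) (b b' : D) (h : hom b b') (g : hom (F a) b),
    adj (h \oc g) = fmap G h \oc adj g
}.

(* T c is isomorphic to c for c in P, naturally in c: T and the identity
   functor are naturally isomorphic when restricted to the full subcategory P
   (components of theta outside P are irrelevant).  Without naturality, the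
   isomorphisms would say nothing about the action of T on the differentials of
   a resolution by objects of P. *)
Definition naturally_iso_id_on (C : preadditiveCat) (T : functor C C)
    (P : C -> Prop) : Prop :=
  exists theta : forall c : C, hom (T c) c,
    (forall c, P c -> is_iso (theta c)) /\
    (forall (c d : C) (f : hom c d), P c -> P d ->
       theta d \oc fmap T f = f \oc theta c).

(* A full subcategory is given by the predicate selecting its objects. *)
Section Subcategories.
Variable C : preadditiveCat.
Implicit Type P : C -> Prop.

Definition subcategory P : Prop :=
  (forall z, zero_object z -> P z) /\
  (forall a b, isomorphic a b -> P a -> P b).

Definition closed_under_extensions P : Prop :=
  forall (a e b : C) (i : hom b e) (p : hom e a),
    mono i -> exact i p -> epi p -> P b -> P a -> P e.

Definition closed_under_summands P : Prop :=
  forall (a b s : C) (ia : hom a s) (ib : hom b s) (pa : hom s a)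
    (pb : hom s b), biproduct ia ib pa pb -> P s -> P a.

Definition precover P (M : C) X (phi : hom X M) : Prop :=
  P X /\ forall X', P X' -> forall f : hom X' M, exists g, f = phi \oc g.

Definition preenvelope P (M : C) Y (phi : hom M Y) : Prop :=
  P Y /\ forall Y', P Y' -> forall f : hom M Y', exists g, f = g \oc phi.

Definition precovering P : Prop :=
  forall M : C, exists X (phi : hom X M), precover P phi.

Definition preenveloping P : Prop :=
  forall M : C, exists Y (phi : hom M Y), preenvelope P phi.

End Subcategories.

Definition image_subcategory (C D : preadditiveCat) (T : functor C D)
    (P : C -> Prop) : D -> Prop :=
  fun d => exists c, P c /\ isomorphic d (T c).

Section YonedaExt.
Variable C : preadditiveCat.

Definition augmented (a : C) (e : nat -> C) (k : nat) : C :=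
  if k is j.+1 then e j else a.

(* An exact sequence 0 -> b -> e_m -> ... -> e_0 -> a -> 0, that is, an
   (m+1)-fold extension of a by b; ext_diff 0 is the map e_0 -> a.  The objects
   and maps of index > m are not part of the sequence; no condition bears on
   them. *)
Record extension (m : nat) (a b : C) := Extension {
  ext_obj : nat -> C;
  ext_diff : forall k, hom (ext_obj k) (augmented a ext_obj k);
  ext_in : hom b (ext_obj m);
  ext_epi : epi (ext_diff 0);
  ext_exact : forall k, (k < m)%N -> exact (ext_diff k.+1) (ext_diff k);
  ext_exact_in : exact ext_in (ext_diff m);
  ext_mono : mono ext_in
}.

(* Morphisms of exact sequences which are the identity on a and b. *)
Definition extension_morphism m a b (E E' : extension m a b) : Prop :=
  exists phi : forall k, hom (ext_obj E k) (ext_obj E' k),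
    [/\ ext_diff E' 0 \oc phi 0 = ext_diff E 0,
        forall k, (k < m)%N ->
          ext_diff E' k.+1 \oc phi k.+1 = phi k \oc ext_diff E k.+1
      & phi m \oc ext_in E = ext_in E'].

Definition yoneda_equiv m a b : relation (extension m a b) :=
  clos_refl_sym_trans _ (@extension_morphism m a b).

(* Ext^(m+1)(a, b) is the group of Yoneda equivalence classes of (m+1)-fold
   extensions of a by b.  It contains at least the class 0, so it vanishes
   exactly when there is only one class. *)
Definition Ext_vanishes m a b : Prop :=
  forall E E' : extension m a b, yoneda_equiv E E'.

Definition self_orthogonal (P : C -> Prop) : Prop :=
  forall i a b, (1 <= i)%N -> P a -> P b -> Ext_vanishes i.-1 a b.

End YonedaExt.

Record cochainComplex := CochainComplex {
  cgroup :> nat -> zmodType;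
  cdiff : forall n, {additive cgroup n -> cgroup n.+1};
  cdiffK : forall n (x : cgroup n), cdiff n.+1 (cdiff n x) = 0
}.

Section Cohomology.
Variables (K : cochainComplex) (n : nat).

Definition cocycle_pred : {pred K n} := [pred x | cdiff K n x == 0].

Fact cocycle_closed : zmod_closed cocycle_pred.
Proof.
split=> [|x y]; first by rewrite inE raddf0.
by rewrite !inE raddfB => /eqP-> /eqP->; rewrite subrr.
Qed.
HB.instance Definition _ :=
  GRing.isZmodClosed.Build (K n) cocycle_pred cocycle_closed.

Definition cocycle : Type := {x : K n | x \in cocycle_pred}.
HB.instance Definition _ := SubChoice.on cocycle.
HB.instance Definition _ := [SubChoice_isSubZmodule of cocycle by <:].

Definition is_coboundary : K n -> Prop :=
  match n return K n -> Prop with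
  | 0 => fun x => x = 0
  | m.+1 => fun x => exists y : K m, x = cdiff K m y
  end.

Definition coboundary_pred : {pred cocycle} :=
  [pred z : cocycle | `[< is_coboundary (val z) >]].

Fact coboundary_closed : zmod_closed coboundary_pred.
Proof.
have sub0 : is_coboundary 0.
  by rewrite /is_coboundary; case: (n) => // m; exists 0; rewrite raddf0.
have subB (x y : K n) :
    is_coboundary x -> is_coboundary y -> is_coboundary (x - y).
  rewrite /is_coboundary; case: (n) x y => [|m] x y.
    by move=> -> ->; rewrite subrr.
  by case=> u -> [v ->]; exists (u - v); rewrite raddfB.
split=> [|x y]; first by rewrite inE; apply/asboolP; rewrite raddf0.
rewrite !inE => /asboolP hx /asboolP hy; apply/asboolP.
by rewrite raddfB; exact: subB.
Qed.
HB.instance Definition _ :=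
  GRing.isZmodClosed.Build cocycle coboundary_pred coboundary_closed.

Definition cohomology : zmodType := Quotient.quot coboundary_pred.

End Cohomology.

Definition group_iso (U V : zmodType) : Prop :=
  exists f : {additive U -> V}, bijective f.

Section HomAdditive.
Variables (C : preadditiveCat) (a b c : C).

Definition precomp (f : hom a b) (g : hom b c) : hom a c := g \oc f.
Definition postcomp (g : hom b c) (f : hom a b) : hom a c := g \oc f.

Fact precomp_zmod f : zmod_morphism (precomp f).
Proof.
by move=> x y; apply/(addIr (precomp f y)); rewrite subrK -compDl subrK.
Qed.
HB.instance Definition _ f :=
  GRing.isZmodMorphism.Build (hom b c) (hom a c) (precomp f) (precomp_zmod f).

Fact postcomp_zmod g : zmod_morphism (postcomp g).
Proof.
by move=> x y; apply/(addIr (postcomp g y)); rewrite subrK -compDr subrK.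
Qed.
HB.instance Definition _ g :=
  GRing.isZmodMorphism.Build (hom a b) (hom a c) (postcomp g) (postcomp_zmod g).

End HomAdditive.

Section RelativeExt.
Variables (C : preadditiveCat) (P : C -> Prop).

(* The fields proper_ spell out that Hom(T, -) turns
   ... -> X_1 -> X_0 -> M -> 0 into an exact complex. *)
Record properLeftResolution (M : C) := ProperLeftResolution {
  lres : nat -> C;
  ldiff : forall n, hom (lres n.+1) (lres n);
  laug : hom (lres 0) M;
  lres_in : forall n, P (lres n);
  laugK : laug \oc ldiff 0 = 0;
  ldiffK : forall n, ldiff n \oc ldiff n.+1 = 0;
  proper_laug : forall T, P T -> forall f : hom T M,
    exists g, f = laug \oc g;
  proper_ldiff0 : forall T, P T -> forall f : hom T (lres 0),
    laug \oc f = 0 -> exists g, f = ldiff 0 \oc g;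
  proper_ldiff : forall T, P T -> forall n (f : hom T (lres n.+1)),
    ldiff n \oc f = 0 -> exists g, f = ldiff n.+1 \oc g
}.

(* The fields coproper_ spell out that Hom(-, T) turns
   0 -> N -> Y^0 -> Y^1 -> ... into an exact complex. *)
Record coproperRightResolution (N : C) := CoproperRightResolution {
  rres : nat -> C;
  rdiff : forall n, hom (rres n) (rres n.+1);
  raug : hom N (rres 0);
  rres_in : forall n, P (rres n);
  raugK : rdiff 0 \oc raug = 0;
  rdiffK : forall n, rdiff n.+1 \oc rdiff n = 0;
  coproper_raug : forall T, P T -> forall f : hom N T,
    exists g, f = g \oc raug;
  coproper_rdiff0 : forall T, P T -> forall f : hom (rres 0) T,
    f \oc raug = 0 -> exists g, f = g \oc rdiff 0;
  coproper_rdiff : forall T, P T -> forall n (f : hom (rres n.+1) T),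
    f \oc rdiff n = 0 -> exists g, f = g \oc rdiff n.+1
}.

Section LeftExt.
Variables (M : C) (X : properLeftResolution M) (N : C).

Fact lhomK n (f : hom (lres X n) N) :
  precomp (ldiff X n.+1) (precomp (ldiff X n) f) = 0.
Proof. by rewrite /precomp -compA ldiffK -[_ \oc 0]/(postcomp f 0) raddf0. Qed.

Definition lhom_complex : cochainComplex :=
  @CochainComplex (fun n => hom (lres X n) N)
    (fun n => precomp (ldiff X n)) lhomK.

Definition left_Ext (i : nat) : zmodType := cohomology lhom_complex i.

End LeftExt.

Section RightExt.
Variables (N : C) (Y : coproperRightResolution N) (M : C).

Fact rhomK n (f : hom M (rres Y n)) :
  postcomp (rdiff Y n.+1) (postcomp (rdiff Y n) f) = 0.
Proof. by rewrite /postcomp compA rdiffK -[0 \oc _]/(precomp f 0) raddf0. Qed.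

Definition rhom_complex : cochainComplex :=
  @CochainComplex (fun n => hom M (rres Y n))
    (fun n => postcomp (rdiff Y n)) rhomK.

Definition right_Ext (i : nat) : zmodType := cohomology rhom_complex i.

End RightExt.

End RelativeExt.

(* Main.v *)
(** Two proper resolutions of an object are homotopy equivalent, so relative Ext
    does not depend on the resolution, and it suffices to compare a proper
    X-resolution of M with its image under G.  As FG is isomorphic to the
    identity on X, so is it through the counit, whence Hom(x, N) is mapped
    bijectively by G to Hom(Gx, GN) for all x in X and N; this shows both that G
    carries the resolution to a proper G(X)-resolution of GM and that the two
    Hom complexes are isomorphic.  (That G is additive is automatic for a right
    adjoint between additive categories.)  Part 2 is part 1 in the opposite
    categories, where F becomes the right adjoint. *)

From HB Require Import structures.
From mathcomp Require Import all_boot all_algebra.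
From mathcomp Require Import boolp.
Require Import Defs.

Set Implicit Arguments.
Unset Strict Implicit.
Unset Printing Implicit Defensive.

Import GRing.Theory.
Local Open Scope ring_scope.
Local Open Scope quotient_scope.

(** * Cohomology of cochain complexes *)

Section CohomologyClasses.
Variables (K : cochainComplex) (n : nat).
Implicit Types (x y : K n) (c d : cohomology K n).

(* Only meaningful on cocycles: [insubd] sends every other cochain to 0. *)
Definition coclass x : cohomology K n :=
  \pi_(Quotient.quot (@coboundary_pred K n)) (insubd (0 : cocycle K n) x).

Definition corep c : K n := val (repr c).

Lemma is_coboundary0 : @is_coboundary K n 0.
Proof.
by rewrite /is_coboundary; case: n => // m; exists 0; rewrite raddf0.
Qed.

Lemma is_coboundaryB x y :
  is_coboundary x -> is_coboundary y -> is_coboundary (x - y).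
Proof.
rewrite /is_coboundary; case: n x y => [|m] x y.
  by move=> -> ->; rewrite subrr.
by case=> u -> [v ->]; exists (u - v); rewrite raddfB.
Qed.

Lemma is_coboundaryD x y :
  is_coboundary x -> is_coboundary y -> is_coboundary (x + y).
Proof.
move=> hx hy; rewrite -[y]opprK -[- y]sub0r; apply: (is_coboundaryB hx).
by apply: is_coboundaryB; first exact: is_coboundary0.
Qed.

Lemma corep_cocycle c : cdiff K n (corep c) = 0.
Proof. by apply/eqP; exact: (valP (repr c)). Qed.

Lemma corepK c : coclass (corep c) = c.
Proof. by rewrite /coclass /corep valKd reprK. Qed.

Lemma val_cocycle x : cdiff K n x = 0 -> val (insubd (0 : cocycle K n) x) = x.
Proof. by move=> /eqP hx; rewrite insubdK. Qed.

Lemma coclass_eq x y : cdiff K n x = 0 -> cdiff K n y = 0 ->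
  coclass x = coclass y <-> is_coboundary (x - y).
Proof.
move=> hx hy.
have eqE : (coclass x == coclass y) = `[< is_coboundary (x - y) >].
  rewrite /coclass -Quotient.idealrBE /= unfold_in /=.
  by rewrite ?raddfB /= !val_cocycle.
split=> [/eqP|h]; first by rewrite eqE => /asboolP.
by apply/eqP; rewrite eqE; apply/asboolP.
Qed.

Lemma corep_coclass x :
  cdiff K n x = 0 -> is_coboundary (corep (coclass x) - x).
Proof. by move=> hx; apply/coclass_eq; rewrite ?corepK ?corep_cocycle. Qed.

Lemma coclassB x y : cdiff K n x = 0 -> cdiff K n y = 0 ->
  coclass (x - y) = coclass x - coclass y.
Proof.
move=> hx hy; rewrite /coclass -raddfB; congr (\pi _); apply: val_inj.
by rewrite raddfB /= !val_cocycle // raddfB hx hy subrr.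
Qed.

Lemma corepB c d : is_coboundary (corep (c - d) - (corep c - corep d)).
Proof.
apply/coclass_eq; first exact: corep_cocycle.
  by rewrite raddfB /= !corep_cocycle subrr.
by rewrite coclassB ?corep_cocycle // !corepK.
Qed.

End CohomologyClasses.

(** Everything happens in degree [n]: maps of cochains that preserve cocycles and coboundaries there
    act on classes, and being mutually inverse up to coboundaries makes these actions inverse. Later
    uses thus need no full chain map. *)
Lemma cohomology_iso (K L : cochainComplex) n
    (u : {additive K n -> L n}) (v : {additive L n -> K n}) :
  (forall x, cdiff K n x = 0 -> cdiff L n (u x) = 0) ->
  (forall y, cdiff L n y = 0 -> cdiff K n (v y) = 0) ->
  (forall x, is_coboundary x -> is_coboundary (u x)) ->
  (forall y, is_coboundary y -> is_coboundary (v y)) ->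
  (forall x, cdiff K n x = 0 -> is_coboundary (v (u x) - x)) ->
  (forall y, cdiff L n y = 0 -> is_coboundary (u (v y) - y)) ->
  group_iso (cohomology K n) (cohomology L n).
Proof.
move=> uZ vZ uB vB vu uv.
pose f (c : cohomology K n) := coclass (u (corep c)).
(* [f] goes through chosen representatives, which are additive only up to coboundaries ([corepB]);
   [u] preserves these. *)
have f_zmod : zmod_morphism f.
  move=> c d; rewrite /f -coclassB ?uZ ?corep_cocycle // -raddfB.
  apply/coclass_eq; rewrite ?uZ ?corep_cocycle ?raddfB ?corep_cocycle ?subrr //.
  by rewrite -!raddfB; apply: uB; rewrite raddfB; exact: corepB.
pose fM := GRing.isZmodMorphism.Build _ _ f f_zmod.
pose fA : {additive cohomology K n -> cohomology L n} := HB.pack f fM.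
pose g (d : cohomology L n) := coclass (v (corep d)).
exists fA, g => [c|d]; rewrite /= /f /g.
  rewrite -[RHS]corepK; apply/coclass_eq; rewrite ?vZ ?corep_cocycle //.
  (* Inserting [v (u (corep c))] separates the error of choosing another representative from that of
     [v] after [u]. *)
  rewrite -(subrK (v (u (corep c))) (v _)) -addrA -raddfB.
  apply: is_coboundaryD; last by apply/vu/corep_cocycle.
  by apply/vB/corep_coclass/uZ/corep_cocycle.
rewrite -[RHS]corepK; apply/coclass_eq; rewrite ?uZ ?corep_cocycle //.
rewrite -(subrK (u (v (corep d))) (u _)) -addrA -raddfB.
apply: is_coboundaryD; last by apply/uv/corep_cocycle.
by apply/uB/corep_coclass/vZ/corep_cocycle.
Qed.

Lemma group_iso_trans (U V W : zmodType) :
  group_iso U V -> group_iso V W -> group_iso U W.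
Proof.
move=> [f f_bij] [g g_bij].
by exists (g \o f : {additive U -> W}); exact: bij_comp.
Qed.

Lemma additive_inverse (U V : zmodType) (f : {additive U -> V}) :
  bijective f -> exists2 g : {additive V -> U}, cancel f g & cancel g f.
Proof.
move=> [g fK gK]; have g_zmod : zmod_morphism g.
  by move=> x y; apply: (can_inj fK); rewrite gK raddfB !gK.
pose gM := GRing.isZmodMorphism.Build _ _ g g_zmod.
by exists (HB.pack g gM : {additive V -> U}).
Qed.

Lemma group_iso_sym (U V : zmodType) : group_iso U V -> group_iso V U.
Proof. by move=> [f /additive_inverse[g fK gK]]; exists g, f. Qed.

(** * Comparison of proper resolutions *)

Section PreadditiveTheory.
Variable C : preadditiveCat.

Lemma comp0m (a b c : C) (f : hom a b) : (0 : hom b c) \oc f = 0.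
Proof. exact: (raddf0 (@precomp C a b c f)). Qed.

Lemma compm0 (a b c : C) (g : hom b c) : g \oc (0 : hom a b) = 0.
Proof. exact: (raddf0 (@postcomp C a b c g)). Qed.

Lemma compBl (a b c : C) (g g' : hom b c) (f : hom a b) :
  (g - g') \oc f = g \oc f - g' \oc f.
Proof. exact: (raddfB (@precomp C a b c f)). Qed.

Lemma compBr (a b c : C) (g : hom b c) (f f' : hom a b) :
  g \oc (f - f') = g \oc f - g \oc f'.
Proof. exact: (raddfB (@postcomp C a b c g)). Qed.

Lemma is_iso_comp (a b c : C) (g : hom b c) (f : hom a b) :
  is_iso g -> is_iso f -> is_iso (g \oc f).
Proof.
move=> [g' [g'g gg']] [f' [f'f ff']]; exists (f' \oc g'); split.
  by rewrite compA -(compA f') g'g compm1.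
by rewrite compA -(compA g) ff' compm1.
Qed.

Lemma isomorphic_sym (a b : C) : isomorphic a b -> isomorphic b a.
Proof. by move=> [f [g [gf fg]]]; exists g, f. Qed.

End PreadditiveTheory.

(** Serves to build chain maps and homotopies degree by degree; [T n] carries the invariant that
    lets the construction continue. *)
Lemma dependent_choice (T : nat -> Type) (R : forall n, T n -> T n.+1 -> Prop)
    (x0 : T 0) :
  (forall n (x : T n), exists y, R n x y) ->
  exists f : forall n, T n, f 0 = x0 /\ forall n, R n (f n) (f n.+1).
Proof.
move=> Rex; pose next n x := projT1 (cid (Rex n x)).
exists (fix f n : T n := if n is m.+1 then next m (f m) else x0).
by split=> // n; exact: (projT2 (cid (Rex n _))).
Qed.

Section Comparison.
Variables (C : preadditiveCat) (P : C -> Prop) (M : C).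
Implicit Types X Y Z : properLeftResolution P M.

Definition lifts_id X Y (u : forall n, hom (lres X n) (lres Y n)) : Prop :=
  laug Y \oc u 0 = laug X /\
  forall n, ldiff Y n \oc u n.+1 = u n \oc ldiff X n.

Lemma lifts_id_exists X Y : exists u, @lifts_id X Y u.
Proof.
(* A state is a whole commuting square: its commutation shows that the next map to be lifted is
   killed by [ldiff Y n]. [R] makes consecutive squares share a side. *)
pose T n := {s : hom (lres X n) (lres Y n) * hom (lres X n.+1) (lres Y n.+1)
  | ldiff Y n \oc s.2 = s.1 \oc ldiff X n}.
pose R n (s : T n) (t : T n.+1) := (sval t).1 = (sval s).2.
have [u0 u0P] := proper_laug Y (lres_in X 0) (laug X).
have [u1 u1P] : exists u1, u0 \oc ldiff X 0 = ldiff Y 0 \oc u1.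
  apply: proper_ldiff0; first exact: lres_in.
  by rewrite compA -u0P laugK.
have Rex n (s : T n) : exists t, R n s t.
  case: s => [[f g] /= fg].
  have [h hP] : exists h, g \oc ldiff X n.+1 = ldiff Y n.+1 \oc h.
    apply: proper_ldiff; first exact: lres_in.
    by rewrite compA fg -compA ldiffK compm0.
  by exists (exist _ (g, h) (esym hP)).
have [u [u0E uR]] := dependent_choice (exist _ (u0, u1) (esym u1P) : T 0) Rex.
exists (fun n => (sval (u n)).1); split=> [|n]; first by rewrite u0E.
by rewrite uR; exact: (svalP (u n)).
Qed.

Lemma lifts_id_comp X Y Z u v :
  @lifts_id X Y u -> @lifts_id Y Z v -> lifts_id (fun n => v n \oc u n).
Proof.
move=> [u0 uS] [v0 vS]; split=> [|n]; first by rewrite compA v0.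
by rewrite compA vS -compA uS compA.
Qed.

Lemma lifts_id_homotopic X Y u v : @lifts_id X Y u -> @lifts_id X Y v ->
  exists s : forall n, hom (lres X n) (lres Y n.+1),
    u 0 - v 0 = ldiff Y 0 \oc s 0 /\
    forall n, u n.+1 - v n.+1 = ldiff Y n.+1 \oc s n.+1 + s n \oc ldiff X n.
Proof.
move=> [u0 uS] [v0 vS].
(* The invariant is exactly what properness of [Y] asks for in order to produce the next component
   of the homotopy. *)
pose T n := {s : hom (lres X n) (lres Y n.+1)
  | ldiff Y n \oc (u n.+1 - v n.+1 - s \oc ldiff X n) = 0}.
pose R n (s : T n) (t : T n.+1) :=
  u n.+1 - v n.+1 - sval s \oc ldiff X n = ldiff Y n.+1 \oc sval t.
have [s0 s0P] : exists s0, u 0 - v 0 = ldiff Y 0 \oc s0.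
  apply: proper_ldiff0; first exact: lres_in.
  by rewrite compBr u0 v0 subrr.
have s0T : ldiff Y 0 \oc (u 1 - v 1 - s0 \oc ldiff X 0) = 0.
  by rewrite !compBr uS vS -compBl compA -s0P subrr.
have Rex n (s : T n) : exists t, R n s t.
  case: s => [s sP]; have [t tP] := proper_ldiff (p:=Y) (lres_in X n.+1) sP.
  have tT : ldiff Y n.+1 \oc (u n.+2 - v n.+2 - t \oc ldiff X n.+1) = 0.
    rewrite !compBr uS vS -compBl compA -tP -compBl subKr.
    by rewrite -compA ldiffK compm0.
  by exists (exist _ t tT).
have [s [s0E sR]] := dependent_choice (exist _ s0 s0T : T 0) Rex.
exists (fun n => sval (s n)); split=> [|n]; first by rewrite s0E.
by rewrite -[LHS](subrK (sval (s n) \oc ldiff X n)) sR.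
Qed.

Variable N : C.

Lemma lifts_id_cocycle X Y u n (f : lhom_complex Y N n) :
  @lifts_id X Y u -> cdiff _ n f = 0 ->
  cdiff (lhom_complex X N) n (f \oc u n) = 0.
Proof.
move=> [_ uS] /= fZ; rewrite /precomp -compA -uS compA.
by rewrite [f \oc _]fZ comp0m.
Qed.

Lemma lifts_id_coboundary X Y u n (f : lhom_complex Y N n) :
  @lifts_id X Y u -> is_coboundary f ->
  @is_coboundary (lhom_complex X N) n (f \oc u n).
Proof.
move=> [_ uS]; case: n f => [|n] f /=; first by move->; rewrite comp0m.
by case=> g ->; exists (g \oc u n); rewrite /precomp -compA uS compA.
Qed.

(** [u] is homotopic to the identity. A cocycle kills the summand of the homotopy that starts with a
    differential of [X], and the other summand is a coboundary; in degree 0 only the first summand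
    occurs. *)
Lemma lifts_id_cohomologous X u n (f : lhom_complex X N n) :
  @lifts_id X X u -> cdiff _ n f = 0 ->
  @is_coboundary (lhom_complex X N) n (f \oc u n - f).
Proof.
move=> u_id fZ.
have id_id : lifts_id (fun n => idm (lres X n)).
  by split=> [|m]; rewrite ?compm1 ?comp1m.
have [s [s0 sS]] := lifts_id_homotopic u_id id_id.
rewrite -[X in _ - X]compm1 -compBr.
case: n f fZ => [|n] f fZ /=; first by rewrite s0 compA [f \oc _]fZ comp0m.
exists (f \oc s n); rewrite sS compDr compA [f \oc _]fZ comp0m add0r.
by rewrite compA.
Qed.

Lemma left_Ext_indep X Y i : group_iso (left_Ext X N i) (left_Ext Y N i).
Proof.
have [u uP] := lifts_id_exists X Y; have [v vP] := lifts_id_exists Y X.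
(* Hom into [N] is contravariant, so the lift [v] from [Y] to [X] gives the map from the complex of
   [X] to that of [Y]. *)
apply: (@cohomology_iso (lhom_complex X N) (lhom_complex Y N) i
  (@precomp C _ _ N (v i)) (@precomp C _ _ N (u i))).
- by move=> f; exact: lifts_id_cocycle.
- by move=> f; exact: lifts_id_cocycle.
- by move=> f; exact: lifts_id_coboundary.
- by move=> f; exact: lifts_id_coboundary.
- move=> f; rewrite /= /precomp -compA.
  exact: lifts_id_cohomologous (lifts_id_comp uP vP).
- move=> f; rewrite /= /precomp -compA.
  exact: lifts_id_cohomologous (lifts_id_comp vP uP).
Qed.

End Comparison.

(** * Existence of proper left resolutions *)

Section Existence.
Variables (C : preadditiveCat) (P : C -> Prop).
Hypothesis C_kernel : forall (a b : C) (f : hom a b),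
  exists (k : C) (m : hom k a), is_kernel f m.
Hypothesis P_precov : precovering P.

(** Compose a kernel with a precover of it; factorizations of maps from objects of [P] survive,
    their uniqueness may not. *)
Lemma weak_kernel_in (a b : C) (f : hom a b) : exists (k : C) (m : hom k a),
  [/\ P k, f \oc m = 0
    & forall T, P T -> forall g : hom T a, f \oc g = 0 ->
        exists h, g = m \oc h].
Proof.
have [k [m [fm mU]]] := C_kernel f; have [x [phi [Px phiP]]] := P_precov k.
exists x, (m \oc phi); split=> //; first by rewrite compA fm comp0m.
move=> T PT g /mU[h [<- _]]; have [l ->] := phiP T PT h.
by exists l; rewrite compA.
Qed.

Lemma properLeftResolution_exists M : inhabited (properLeftResolution P M).
Proof.
have [ker [ker_in kerP]] : exists (ker : forall a b : C, hom a b -> C)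
    (ker_in : forall a b f, hom (ker a b f) a), forall (a b : C) (f : hom a b),
    [/\ P (ker a b f), f \oc ker_in a b f = 0
      & forall T, P T -> forall g : hom T a, f \oc g = 0 ->
          exists h, g = ker_in a b f \oc h].
  exists (fun a b f => projT1 (cid (weak_kernel_in f))).
  exists (fun a b f => projT1 (cid (projT2 (cid (weak_kernel_in f))))) => a b f.
  exact: (projT2 (cid (projT2 (cid (weak_kernel_in f))))).
have [x [phi [Px phiP]]] := P_precov M.
(* Objects and differentials are built together, so each arrow is packed with its ends. Arrow 0 is
   the augmentation [phi], hence the shift in [d]. *)
pose Arrow (a b : C) (f : hom a b) : {a : C & {b : C & hom a b}} :=
  existT _ a (existT (hom a) b f).
pose fix arrow n := if n is m.+1
  then Arrow _ _ (ker_in _ _ (projT2 (projT2 (arrow m)))) else Arrow x M phi.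
have arrow_in n : P (projT1 (arrow n))
  by case: n => //= n; case: (kerP _ _ (projT2 (projT2 (arrow n)))).
pose d n : hom (projT1 (arrow n.+1)) (projT1 (arrow n)) :=
  projT2 (projT2 (arrow n.+1)).
apply: inhabits; apply: (@ProperLeftResolution _ P M _ d phi) => //=.
- by case: (kerP _ _ phi).
- by move=> n; case: (kerP _ _ (d n)).
- by case: (kerP _ _ phi).
- by move=> T PT n f; case: (kerP _ _ (d n)) => _ _; exact.
Qed.

End Existence.

(** * Right adjoints and relative Ext *)

Section Functors.
Variables (C D : preadditiveCat) (F : functor C D).

Lemma fmap_is_iso (a b : C) (f : hom a b) : is_iso f -> is_iso (fmap F f).
Proof.
by move=> [g [gf fg]]; exists (fmap F g); rewrite -!fmap_comp gf fg !fmap_id.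
Qed.

End Functors.

(** * The counit, and full faithfulness of the right adjoint where the counit is invertible *)

Section Adjunctions.
Variables (C D : preadditiveCat) (F : functor C D) (G : functor D C).
Variable FG : adjunction F G.

Lemma adj_inj (a : C) (b : D) : injective (@adj _ _ _ _ FG a b).
Proof. exact: bij_inj (adj_bij FG a b). Qed.

Lemma adj_surj (a : C) (b : D) (f : hom a (G b)) :
  exists g : hom (F a) b, adj FG g = f.
Proof. by have [h _ hK] := adj_bij FG a b; exists (h f). Qed.

Definition counit (b : D) : hom (F (G b)) b :=
  projT1 (cid (adj_surj (idm (G b)))).

Lemma adj_counit b : adj FG (counit b) = idm (G b).
Proof. exact: projT2 (cid (adj_surj (idm (G b)))). Qed.

Lemma adj_comp_counit (b b' : D) (h : hom b b') :
  adj FG (h \oc counit b) = fmap G h.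
Proof. by rewrite adj_natr adj_counit compm1. Qed.

Lemma adj_counit_fmap (a : C) (b : D) (f : hom a (G b)) :
  adj FG (counit b \oc fmap F f) = f.
Proof. by rewrite adj_natl adj_counit comp1m. Qed.

Lemma counit_natural (b b' : D) (h : hom b b') :
  h \oc counit b = counit b' \oc fmap F (fmap G h).
Proof. by apply: adj_inj; rewrite adj_comp_counit adj_counit_fmap. Qed.

Lemma counit_unit (a : C) :
  counit (F a) \oc fmap F (adj FG (idm (F a))) = idm (F a).
Proof. by apply: adj_inj; rewrite adj_counit_fmap. Qed.

(* Read through theta, the counit becomes an endomorphism r of the identity
   functor of P, which is central; a section of r is therefore an inverse. *)
Lemma counit_is_iso (P : D -> Prop) :
  (forall a b, isomorphic a b -> P a -> P b) ->
  naturally_iso_id_on (fcomp F G) P -> forall b, P b -> is_iso (counit b).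
Proof.
move=> P_iso [theta [theta_iso theta_nat]] b Pb.
have thetab_iso := theta_iso b Pb.
(* The triangle identity [counit_unit] provides a section of the counit only at objects in the image
   of [F]. Hence the argument is run at [y] and carried back to [b] along [theta b] by
   naturality. *)
set y := F (G b); have Py : P y.
  by apply: P_iso Pb; apply: isomorphic_sym; exists (theta b).
have [t [ty yt]] := theta_iso y Py.
pose r := counit y \oc t.
pose s := theta y \oc fmap F (adj FG (idm y)).
have rs : r \oc s = idm y.
  by rewrite /r /s -compA (compA t) ty comp1m counit_unit.
have sr : s \oc r = idm y.
  rewrite -rs {1}/r compA counit_natural.
  rewrite -[fmap F (fmap G s)]comp1m -[idm _]ty.
  have := theta_nat y y s Py Py; rewrite /= -(compA t) => ->.
  by rewrite -/y !compA -(compA _ (theta y) t) yt compm1.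
have counity_iso : is_iso (counit y).
  exists (t \oc s); split; last by rewrite compA.
  rewrite -[counit y]compm1 -[idm (F (G y))]ty (compA (counit y)) -/r.
  by rewrite -(compA t s) (compA s) sr comp1m ty.
have [t' [t'b bt']] := thetab_iso.
have -> : counit b = theta b \oc counit y \oc fmap F (fmap G t').
  by rewrite counit_natural -compA -!fmap_comp bt' !fmap_id compm1.
apply: is_iso_comp; first exact: is_iso_comp.
by do 2!apply: fmap_is_iso; exists (theta b).
Qed.

(** Through the adjunction, the action of [G] is precomposition with [counit b]; invertibility is
    thus required at the source only, and [b'] is arbitrary. *)
Lemma fmap_right_inj (b b' : D) : is_iso (counit b) ->
  injective (fun h : hom b b' => fmap G h).
Proof.
move=> [e [_ be]] h h'; rewrite -!adj_comp_counit => /adj_inj hh'.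
by rewrite -[h]compm1 -[h']compm1 -be !compA hh'.
Qed.

Lemma fmap_right_surj (b b' : D) (f : hom (G b) (G b')) : is_iso (counit b) ->
  exists h : hom b b', fmap G h = f.
Proof.
move=> [e [eb _]]; have [g <-] := adj_surj f.
by exists (g \oc e); rewrite -adj_comp_counit -compA eb compm1.
Qed.

(** * Additivity of a right adjoint *)

Hypothesis D_zero : exists z : D, zero_object z.

(** The adjunction is a bijection of sets, and maps into [G z] correspond to maps into [z], of which
    there is one. So [G z] has zero identity, and the zero map factors through [z]. *)
Lemma fmap_right0 (b b' : D) : fmap G (0 : hom b b') = 0.
Proof.
have [z zP] := D_zero; have Gz : idm (G z) = 0.
  have [f <-] := adj_surj (idm (G z)).
  have [g <-] := adj_surj (0 : hom (G z) (G z)).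
  by rewrite ((zP _).1 f) ((zP _).1 g).
rewrite -(comp0m b' (0 : hom b z)) fmap_comp -[fmap G (0 : hom z b')]compm1 Gz.
by rewrite compm0 comp0m.
Qed.

Hypothesis D_biproduct : forall a b : D, exists (s : D)
  (ia : hom a s) (ib : hom b s) (pa : hom s a) (pb : hom s b),
  biproduct ia ib pa pb.

(* A right adjoint preserves the product b' x b', and f + g factors through
   it. *)
Lemma fmap_rightD (b b' : D) (f g : hom b b') :
  fmap G (f + g) = fmap G f + fmap G g.
Proof.
have [s [i [j [p [q [pi qj pj qi ipjq]]]]]] := D_biproduct b' b'.
have joint (a : C) (u v : hom a (G s)) : fmap G p \oc u = fmap G p \oc v ->
    fmap G q \oc u = fmap G q \oc v -> u = v.
  have [u' <-] := adj_surj u; have [v' <-] := adj_surj v.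
  rewrite -!adj_natr => /adj_inj pE /adj_inj qE; congr (adj FG _).
  by rewrite -[u']comp1m -[v']comp1m -ipjq !compDl -!compA pE qE.
have Gs : fmap G i \oc fmap G p + fmap G j \oc fmap G q = idm (G s).
  apply: joint; rewrite compDr !compA -!fmap_comp.
    by rewrite pi pj comp1m comp0m fmap_right0 addr0 compm1.
  by rewrite qi qj comp1m comp0m fmap_right0 add0r compm1.
(* [k] has components [f] and [g], so [f + g] is [p + q] after [k]; the decomposition [Gs] then
   splits [fmap G (p + q)] into the images of [p] and [q]. *)
pose k := i \oc f + j \oc g.
have pk : p \oc k = f by rewrite compDr !compA pi pj comp0m addr0 comp1m.
have qk : q \oc k = g by rewrite compDr !compA qi qj comp0m add0r comp1m.
rewrite -{1}pk -{1}qk -compDl fmap_comp -[fmap G (p + q)]compm1 -Gs.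
rewrite compDr !compA -!fmap_comp !compDl pi qi pj qj !comp0m !comp1m.
by rewrite addr0 add0r -!fmap_comp pk qk.
Qed.

Lemma fmap_right_zmod (b b' : D) :
  zmod_morphism (fun f : hom b b' => fmap G f).
Proof.
by move=> f g; apply: (addIr (fmap G g)); rewrite subrK -fmap_rightD subrK.
Qed.

(** * The image of a proper resolution under the right adjoint *)

Variable P : D -> Prop.
Hypothesis counit_iso : forall b, P b -> is_iso (counit b).

Section ImageResolution.
Variables (M : D) (X : properLeftResolution P M).

(** A test object is isomorphic to some [G b'] with [b'] in [P]. Fullness pulls the test map back to
    [b'], faithfulness keeps its composite with [e] zero, and the lift found in [D] is sent back by
    [G]. *)
Lemma image_lift (a b c : D) (d : hom a b) (e : hom b c) (T : C)
    (f : hom T (G b)) :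
  (forall T', P T' -> forall g : hom T' b, e \oc g = 0 ->
    exists h, g = d \oc h) ->
  image_subcategory G P T -> fmap G e \oc f = 0 -> exists h, f = fmap G d \oc h.
Proof.
move=> dP [b' [Pb' [t [t' [t't tt']]]]] ef0.
have [g gE] := fmap_right_surj (f \oc t') (counit_iso Pb').
have eg : e \oc g = 0.
  apply: (fmap_right_inj (counit_iso Pb')).
  by rewrite /= fmap_comp gE compA ef0 comp0m fmap_right0.
have [h hE] := dP b' Pb' g eg; exists (fmap G h \oc t).
by rewrite compA -fmap_comp -hE gE -compA t't compm1.
Qed.

Lemma imageResolution_in n : image_subcategory G P (G (lres X n)).
Proof.
exists (lres X n); split; first exact: lres_in.
by exists (idm _), (idm _); rewrite comp1m.
Qed.

Lemma imageResolution_augK :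
  fmap G (laug X) \oc fmap G (ldiff X 0) = 0.
Proof. by rewrite -fmap_comp laugK fmap_right0. Qed.

Lemma imageResolution_diffK n :
  fmap G (ldiff X n) \oc fmap G (ldiff X n.+1) = 0.
Proof. by rewrite -fmap_comp ldiffK fmap_right0. Qed.

Lemma imageResolution_aug T : image_subcategory G P T ->
  forall f : hom T (G M), exists g, f = fmap G (laug X) \oc g.
Proof.
(* With [e] zero the vanishing condition is void, so exactness at [M] becomes surjectivity onto maps
   into [M]. *)
move=> PT f; apply: (@image_lift _ _ _ (laug X) (0 : hom M M)) => //.
  by move=> T' PT' g _; exact: proper_laug.
by rewrite fmap_right0 comp0m.
Qed.

Definition imageResolution :
    properLeftResolution (image_subcategory G P) (G M) :=
  ProperLeftResolution imageResolution_in imageResolution_augK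
    imageResolution_diffK imageResolution_aug
    (fun T PT f =>
       image_lift (fun T' PT' g => @proper_ldiff0 _ _ _ X T' PT' g) PT)
    (fun T PT n f =>
       image_lift (fun T' PT' g => @proper_ldiff _ _ _ X T' PT' n g) PT).

Lemma left_Ext_image N i :
  group_iso (left_Ext X N i) (left_Ext imageResolution (G N) i).
Proof.
pose uM n := GRing.isZmodMorphism.Build _ _ _ (@fmap_right_zmod (lres X n) N).
pose u n : {additive hom (lres X n) N -> hom (G (lres X n)) (G N)} :=
  HB.pack (fun f : hom (lres X n) N => fmap G f) (uM n).
have u_bij n : bijective (u n).
  have uX (g : hom (G (lres X n)) (G N)) : exists f, u n f = g.
    by apply: fmap_right_surj; apply: counit_iso; exact: lres_in.
  exists (fun g => projT1 (cid (uX g))) => [f|g];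
    last exact: projT2 (cid (uX g)).
  apply: (fmap_right_inj (counit_iso (lres_in X n))).
  exact: projT2 (cid (uX (u n f))).
have [v uK vK] := additive_inverse (u_bij i).
have ud n (f : hom (lres X n) N) :
  u n.+1 (f \oc ldiff X n) = u n f \oc fmap G (ldiff X n) by exact: fmap_comp.
apply: (@cohomology_iso (lhom_complex X N)
  (lhom_complex imageResolution (G N)) i (u i) v).
- move=> f fZ; change (u i f \oc fmap G (ldiff X i) = 0).
  by rewrite -ud [f \oc _]fZ raddf0.
- move=> g gZ; apply: (bij_inj (u_bij i.+1)); rewrite raddf0.
  rewrite -[RHS]gZ.
  change (u i.+1 (v g \oc ldiff X i) = g \oc fmap G (ldiff X i)).
  by rewrite ud vK.
- case: (i) => [|n] f; first by move->; apply: (raddf0 (u 0)).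
  case=> g ->; exists (u n g); exact: ud.
- case: (i) v uK vK => [|n] v uK vK g; first by move->; apply: (raddf0 v).
  (* [v] inverts [u] in degree [n.+1] only; the bounding cochain lies in degree [n] and needs the
     inverse [w] there. *)
  have [w _ wK] := u_bij n.
  case=> h ->; exists (w h); apply: (bij_inj (u_bij n.+1)).
  by rewrite vK; have /esym := ud n (w h); rewrite wK.
- by move=> f _; rewrite uK subrr; exact: is_coboundary0.
- by move=> g _; rewrite vK subrr; exact: is_coboundary0.
Qed.

End ImageResolution.

End Adjunctions.

Section LeftHalf.
Variables (C D : preadditiveCat) (F : functor C D) (G : functor D C).
Variables (FG : adjunction F G) (P : D -> Prop).
Hypothesis D_abelian : is_abelian D.
Hypothesis P_iso : forall a b, isomorphic a b -> P a -> P b.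
Hypothesis P_precov : precovering P.
Hypothesis FG_id : naturally_iso_id_on (fcomp F G) P.

Lemma left_Ext_right_adjoint (M N : D) :
  [/\ inhabited (properLeftResolution P M),
      inhabited (properLeftResolution (image_subcategory G P) (G M))
    & forall (X : properLeftResolution P M)
        (Z : properLeftResolution (image_subcategory G P) (G M)) (i : nat),
        group_iso (left_Ext X N i) (left_Ext Z (G N) i)].
Proof.
have [D_zero D_biprod D_ker _ _ _] := D_abelian.
have iso_counit := counit_is_iso FG P_iso FG_id.
have [X0] := properLeftResolution_exists D_ker P_precov M.
pose image (X : properLeftResolution P M) :=
  imageResolution D_zero iso_counit X.
split=> [||X Z i]; [exact: inhabits X0|exact: inhabits (image X0)|].
(* [Z] is an arbitrary resolution of [G M]; independence of the resolution links it to the image of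
   [X]. *)
apply: group_iso_trans (left_Ext_indep (G N) (image X) Z i).
exact: left_Ext_image.
Qed.

End LeftHalf.

(** * Opposite categories *)

Section Opposite.
Variable C : preadditiveCat.

Definition opcomp (a b c : C) (g : hom c b) (f : hom b a) : hom c a := f \oc g.

Definition op : preadditiveCat := @PreadditiveCat C (fun a b => hom b a)
  (@idm C) opcomp (fun a b c d h g f => esym (compA f g h))
  (fun a b f => compm1 f) (fun a b f => comp1m f)
  (fun a b c g g' f => compDr f g g') (fun a b c g f f' => compDl f f' g).

Lemma op_is_abelian : is_abelian C -> is_abelian op.
Proof.
move=> [zeroC biC kerC cokerC monoC epiC]; split=> //.
- by have [z zP] := zeroC; exists z => a; have [] := zP a.
- move=> a b; have [s [ia [ib [pa [pb [h1 h2 h3 h4 h5]]]]]] := biC a b.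
  by exists s, pa, pb, ia, ib.
- by move=> a b f; exact: (cokerC b a f).
- by move=> a b f; exact: (kerC b a f).
- by move=> a b m; exact: (epiC b a m).
- by move=> a b q; exact: (monoC b a q).
Qed.

Lemma op_isomorphic (a b : C) : @isomorphic op a b <-> @isomorphic C a b.
Proof. by split=> -[f [g [gf fg]]]; exists g, f. Qed.

End Opposite.

Section OppositeFunctors.
Variables (C D : preadditiveCat).

Definition opfunctor (F : functor C D) : functor (op C) (op D) :=
  @Functor (op C) (op D) F (fun a b f => fmap F f) (fmap_id F)
    (fun a b c g f => fmap_comp F f g).

(** Stated as an equality of predicates so that it can rewrite the types of resolutions depending on
    them. *)
Lemma op_image_subcategory (F : functor C D) (P : C -> Prop) :
  @image_subcategory (op C) (op D) (opfunctor F) P = image_subcategory F P.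
Proof.
by apply/funext => d; apply/propext; split=> -[c [Pc dFc]];
  exists c; split=> //; exact/op_isomorphic.
Qed.

End OppositeFunctors.

Section OppositeAdjunction.
Variables (C D : preadditiveCat) (F : functor C D) (G : functor D C).
Variable FG : adjunction F G.

Definition adjinv (a : C) (b : D) (f : hom a (G b)) : hom (F a) b :=
  projT1 (cid (adj_surj FG f)).

Lemma adjinvK a b : cancel (@adjinv a b) (@adj _ _ _ _ FG a b).
Proof. by move=> f; exact: projT2 (cid (adj_surj FG f)). Qed.

Lemma adjinv_bij a b : bijective (@adjinv a b).
Proof.
exists (@adj _ _ _ _ FG a b) => [f|g]; first exact: adjinvK.
by apply: (@adj_inj _ _ _ _ FG); rewrite adjinvK.
Qed.

Lemma adjinv_natl (a a' : C) (b : D) (g : hom a (G b)) (f : hom a' a) :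
  adjinv (g \oc f) = adjinv g \oc fmap F f.
Proof. by apply: (@adj_inj _ _ _ _ FG); rewrite adj_natl !adjinvK. Qed.

Lemma adjinv_natr (a : C) (b b' : D) (h : hom b b') (g : hom a (G b)) :
  adjinv (fmap G h \oc g) = h \oc adjinv g.
Proof. by apply: (@adj_inj _ _ _ _ FG); rewrite adj_natr !adjinvK. Qed.

Definition opadjunction : adjunction (opfunctor G) (opfunctor F) :=
  @Adjunction (op D) (op C) (opfunctor G) (opfunctor F)
    (fun b a f => @adjinv a b f) (fun b a => adjinv_bij a b)
    (fun b b' a g f => adjinv_natr f g) (fun b a a' h g => adjinv_natl g h).

End OppositeAdjunction.

(** Reversing arrows turns each [theta c] the wrong way round, so the inverses are the new
    components. *)
Lemma op_naturally_iso_id_on (C : preadditiveCat) (T : functor C C)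
    (P : C -> Prop) :
  naturally_iso_id_on T P -> @naturally_iso_id_on (op C) (opfunctor T) P.
Proof.
move=> [theta [theta_iso theta_nat]].
have inv_ex c : exists t : hom c (T c),
    P c -> t \oc theta c = idm (T c) /\ theta c \oc t = idm c.
  have [/theta_iso [t tP]|nPc] := pselect (P c); first by exists t.
  (* Components outside [P] are irrelevant, so 0 is the default. *)
  by exists 0.
pose t c := projT1 (cid (inv_ex c)).
have tP c := projT2 (cid (inv_ex c)) : P c -> t c \oc _ = _ /\ _ \oc t c = _.
exists t; split=> [c Pc|c d f Pc Pd].
  by have [tth tht] := tP c Pc; exists (theta c).
have [_ thd] := tP d Pd; have [thc _] := tP c Pc.
change (fmap T f \oc t d = t c \oc f).
rewrite -[LHS]comp1m -thc -compA (compA (theta c)) theta_nat //.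
by rewrite -[X in _ \oc X]compA thd compm1.
Qed.

(** * Coproper resolutions as proper resolutions in the opposite category *)

Section OppositeResolutions.
Variables (C : preadditiveCat) (P : C -> Prop) (N : C).

Definition coproper_of_op (X : @properLeftResolution (op C) P N) :
    coproperRightResolution P N :=
  @CoproperRightResolution C P N (lres X) (ldiff X) (laug X) (lres_in X)
    (laugK X) (ldiffK X) (proper_laug X)
    (@proper_ldiff0 _ _ _ X) (@proper_ldiff _ _ _ X).

Definition op_of_coproper (Y : coproperRightResolution P N) :
    @properLeftResolution (op C) P N :=
  @ProperLeftResolution (op C) P N (rres Y) (rdiff Y) (raug Y) (rres_in Y)
    (raugK Y) (rdiffK Y) (coproper_raug Y)
    (@coproper_rdiff0 _ _ _ Y) (@coproper_rdiff _ _ _ Y).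

(** Precomposition in the opposite category is postcomposition in [C], so the two Hom complexes
    agree by conversion and the identity serves both ways. *)
Lemma right_Ext_op (Y : coproperRightResolution P N) (M : C) i :
  group_iso (right_Ext Y M i) (@left_Ext (op C) P N (op_of_coproper Y) M i).
Proof.
pose K := rhom_complex Y M.
pose L := @lhom_complex (op C) P N (op_of_coproper Y) M.
apply: (@cohomology_iso K L i
  (idfun : {additive hom M (rres Y i) -> hom M (rres Y i)})
  (idfun : {additive hom M (rres Y i) -> hom M (rres Y i)})) => //.
- by move=> x _; rewrite subrr; exact: is_coboundary0.
- by move=> x _; rewrite subrr; exact: is_coboundary0.
Qed.

End OppositeResolutions.

Lemma right_Ext_left_adjoint (C D : preadditiveCat) (F : functor C D)
    (G : functor D C) (FG : adjunction F G) (P : C -> Prop) :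
  is_abelian C -> (forall a b, isomorphic a b -> P a -> P b) ->
  preenveloping P -> naturally_iso_id_on (fcomp G F) P ->
  forall M N : C,
  [/\ inhabited (coproperRightResolution P N),
      inhabited (coproperRightResolution (image_subcategory F P) (F N))
    & forall (Y : coproperRightResolution P N)
        (Z : coproperRightResolution (image_subcategory F P) (F N)) (i : nat),
        group_iso (right_Ext Y M i) (right_Ext Z (F M) i)].
Proof.
move=> C_ab P_iso P_preenv GF_id M N.
have op_P_iso (a b : op C) : isomorphic a b -> P a -> P b.
  by move=> /op_isomorphic; exact: P_iso.
(* [P_preenv] is by conversion precovering in the opposite category. The object resolved is now [N],
   hence the exchanged order [N M]. *)
have := left_Ext_right_adjoint (opadjunction FG) (op_is_abelian C_ab) op_P_iso
  P_preenv (op_naturally_iso_id_on GF_id) N M.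
rewrite op_image_subcategory => -[[X] [Z] iso].
split=> [||Y W i]; [exact: inhabits (coproper_of_op X)|
  exact: inhabits (coproper_of_op Z)|].
apply: group_iso_trans (right_Ext_op Y M i) _.
apply: group_iso_trans (iso _ (op_of_coproper W) i) _.
exact/group_iso_sym/right_Ext_op.
Qed.

Theorem theorem5p3 (A B : abelianCat) (F : functor A B) (G : functor B A)
    (FG_adj : adjunction F G) (Y : A -> Prop) (X : B -> Prop)
    (Y_sub : subcategory Y) (X_sub : subcategory X)
    (Y_preenv : preenveloping Y) (X_precov : precovering X)
    (Y_orth : self_orthogonal Y) (X_orth : self_orthogonal X)
    (Y_ext : closed_under_extensions Y) (X_ext : closed_under_extensions X)
    (Y_summand : closed_under_summands Y)
    (X_summand : closed_under_summands X) :
  (naturally_iso_id_on (fcomp F G) X ->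
     forall M N : B,
       [/\ inhabited (properLeftResolution X M),
           inhabited (properLeftResolution (image_subcategory G X) (G M))
         & forall (P : properLeftResolution X M)
             (Q : properLeftResolution (image_subcategory G X) (G M)) (i : nat),
             group_iso (left_Ext P N i) (left_Ext Q (G N) i)]) /\
  (naturally_iso_id_on (fcomp G F) Y ->
     forall M N : A,
       [/\ inhabited (coproperRightResolution Y N),
           inhabited (coproperRightResolution (image_subcategory F Y) (F N))
         & forall (P : coproperRightResolution Y N)
             (Q : coproperRightResolution (image_subcategory F Y) (F N))
             (i : nat),
             group_iso (right_Ext P M i) (right_Ext Q (F M) i)]).
Proof.
split=> [FG_id M N | GF_id M N].
- exact: (left_Ext_right_adjoint FG_adj (abelianP B) X_sub.2 X_precov FG_id).
- exact: (right_Ext_left_adjoint FG_adj (abelianP A) Y_sub.2 Y_preenv GF_id).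
Qed.
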